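(* For every $\Sigma_1(\Box)$ formula $\varphi$, $\mathsf{PA}(\mathsf{K4}) \vdash \varphi \to \Box\varphi$.
   Context: The language $\mathcal{L}_A(\Box)$ is the language of arithmetic $\{0,S,+,\times,\le,=\}$ plus a unary modal operator $\Box$. All theories use the rules modus ponens, generalization, and necessitation (from $\varphi$ infer $\Box\varphi$). $\mathsf{PA}_\Box$ is Peano arithmetic plus the first-order logical axioms for $\mathcal{L}_A(\Box)$-formulas (including universal instantiation for $\mathcal{L}_A$-terms) plus induction for all $\mathcal{L}_A(\Box)$-formulas. $\mathsf{PA}(\mathsf{K})$ is $\mathsf{PA}_\Box$ plus the universal closures of all $\Box(\varphi\to\psi)\to(\Box\varphi\to\Box\psi)$, and $\mathsf{PA}(\mathsf{K4})$ is $\mathsf{PA}(\mathsf{K})$ plus the universal closures of all $\Box\varphi\to\Box\Box\varphi$ ($\varphi,\psi$ arbitrary $\mathcal{L}_A(\Box)$-formulas). The class $\Sigma_1(\Box)$ is the smallest class of $\mathcal{L}_A(\Box)$-formulas containing all $\Sigma_1$ arithmetic formulas and all formulas of the form $\Box\varphi$, and closed under $\land$, $\lor$, $\exists x$, and $\forall x<t$ for $\mathcal{L}_A$-terms $t$ not containing $x$. *)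

(* Defs.v *)
(* First-order syntax is in de Bruijn style: variable 0 is bound by the nearest
   enclosing quantifier, and an index pointing past all the binders is a free
   variable.  [Box] binds nothing, so [Box phi] has the same free variables as
   [phi], and substitution acts inside it. *)

Inductive term : Type :=
| Var : nat -> term
| Zero : term
| Succ : term -> term
| Plus : term -> term -> term
| Mult : term -> term -> term.

Inductive form : Type :=
| Eq : term -> term -> form
| Le : term -> term -> form
| Bot : form
| And : form -> form -> form
| Or : form -> form -> form
| Imp : form -> form -> form
| All : form -> form
| Ex : form -> form
| Box : form -> form.

Definition Neg (phi : form) : form := Imp phi Bot.
Definition Iff (phi psi : form) : form := And (Imp phi psi) (Imp psi phi).
Definition Lt (s t : term) : form := Le (Succ s) t.

Fixpoint tsubst (sigma : nat -> term) (t : term) : term :=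
  match t with
  | Var n => sigma n
  | Zero => Zero
  | Succ s => Succ (tsubst sigma s)
  | Plus s u => Plus (tsubst sigma s) (tsubst sigma u)
  | Mult s u => Mult (tsubst sigma s) (tsubst sigma u)
  end.

Definition scons (t : term) (sigma : nat -> term) (n : nat) : term :=
  match n with
  | 0 => t
  | S m => sigma m
  end.

Definition shift (n : nat) : term := Var (S n).

Definition up (sigma : nat -> term) : nat -> term :=
  scons (Var 0) (fun n => tsubst shift (sigma n)).

Fixpoint subst (sigma : nat -> term) (phi : form) : form :=
  match phi with
  | Eq s t => Eq (tsubst sigma s) (tsubst sigma t)
  | Le s t => Le (tsubst sigma s) (tsubst sigma t)
  | Bot => Bot
  | And a b => And (subst sigma a) (subst sigma b)
  | Or a b => Or (subst sigma a) (subst sigma b)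
  | Imp a b => Imp (subst sigma a) (subst sigma b)
  | All a => All (subst (up sigma) a)
  | Ex a => Ex (subst (up sigma) a)
  | Box a => Box (subst sigma a)
  end.

(* [inst t phi] is phi(t) for the body phi of a quantifier; [lift phi] is phi
   seen under one more binder, whose variable does not occur in it. *)
Definition inst (t : term) : form -> form := subst (scons t Var).
Definition tlift : term -> term := tsubst shift.
Definition lift : form -> form := subst shift.

(* Bounded quantifiers over variable 0: the bound t lives outside the binder,
   so that the quantified variable does not occur in it. *)
Definition AllLt (t : term) (phi : form) : form :=
  All (Imp (Lt (Var 0) (tlift t)) phi).
Definition ExLt (t : term) (phi : form) : form :=
  Ex (And (Lt (Var 0) (tlift t)) phi).
Definition AllLe (t : term) (phi : form) : form :=
  All (Imp (Le (Var 0) (tlift t)) phi).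
Definition ExLe (t : term) (phi : form) : form :=
  Ex (And (Le (Var 0) (tlift t)) phi).

(* Least n such that all free variables are among 0, ..., n-1. *)
Fixpoint tbound (t : term) : nat :=
  match t with
  | Var n => S n
  | Zero => 0
  | Succ s => tbound s
  | Plus s u | Mult s u => Nat.max (tbound s) (tbound u)
  end.

Fixpoint bound (phi : form) : nat :=
  match phi with
  | Eq s t | Le s t => Nat.max (tbound s) (tbound t)
  | Bot => 0
  | And a b | Or a b | Imp a b => Nat.max (bound a) (bound b)
  | All a | Ex a => Nat.pred (bound a)
  | Box a => bound a
  end.

Definition uclosure (phi : form) : form := Nat.iter (bound phi) All phi.

(* Classical first-order logic with equality.  The equality axioms are
   reflexivity and congruence for the symbols of the language of arithmetic;
   replacement of equals inside [Box] is not postulated: over the axiom K it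
   follows from x = y -> [Box] (x = y), which is proved by induction. *)
Inductive logical_axiom : form -> Prop :=
| ax_K a b : logical_axiom (Imp a (Imp b a))
| ax_S a b c :
    logical_axiom (Imp (Imp a (Imp b c)) (Imp (Imp a b) (Imp a c)))
| ax_and_l a b : logical_axiom (Imp (And a b) a)
| ax_and_r a b : logical_axiom (Imp (And a b) b)
| ax_and_i a b : logical_axiom (Imp a (Imp b (And a b)))
| ax_or_l a b : logical_axiom (Imp a (Or a b))
| ax_or_r a b : logical_axiom (Imp b (Or a b))
| ax_or_e a b c :
    logical_axiom (Imp (Imp a c) (Imp (Imp b c) (Imp (Or a b) c)))
| ax_bot a : logical_axiom (Imp Bot a)
| ax_dne a : logical_axiom (Imp (Neg (Neg a)) a)
| ax_all_e a t : logical_axiom (Imp (All a) (inst t a))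
| ax_all_i a b : logical_axiom (Imp (All (Imp (lift a) b)) (Imp a (All b)))
| ax_ex_i a t : logical_axiom (Imp (inst t a) (Ex a))
| ax_ex_e a b : logical_axiom (Imp (All (Imp a (lift b))) (Imp (Ex a) b))
| ax_eq_refl t : logical_axiom (Eq t t)
| ax_eq_succ s t : logical_axiom (Imp (Eq s t) (Eq (Succ s) (Succ t)))
| ax_eq_plus s s' t t' :
    logical_axiom
      (Imp (Eq s s') (Imp (Eq t t') (Eq (Plus s t) (Plus s' t'))))
| ax_eq_mult s s' t t' :
    logical_axiom
      (Imp (Eq s s') (Imp (Eq t t') (Eq (Mult s t) (Mult s' t'))))
| ax_eq_eq s s' t t' :
    logical_axiom (Imp (Eq s s') (Imp (Eq t t') (Imp (Eq s t) (Eq s' t'))))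
| ax_eq_le s s' t t' :
    logical_axiom (Imp (Eq s s') (Imp (Eq t t') (Imp (Le s t) (Le s' t')))).

(* Generalization over another variable than 0, and the rule of substitution,
   are derivable from [pr_gen] and [ax_all_e]. *)
Inductive proves (T : form -> Prop) : form -> Prop :=
| pr_logic a : logical_axiom a -> proves T a
| pr_ax a : T a -> proves T a
| pr_mp a b : proves T (Imp a b) -> proves T a -> proves T b
| pr_gen a : proves T a -> proves T (All a)
| pr_nec a : proves T a -> proves T (Box a).

Inductive PA_Box : form -> Prop :=
| pa_succ_neq_zero : PA_Box (All (Neg (Eq (Succ (Var 0)) Zero)))
| pa_succ_inj :
    PA_Box (All (All (Imp (Eq (Succ (Var 1)) (Succ (Var 0)))
                          (Eq (Var 1) (Var 0)))))
| pa_plus_zero : PA_Box (All (Eq (Plus (Var 0) Zero) (Var 0)))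
| pa_plus_succ :
    PA_Box (All (All (Eq (Plus (Var 1) (Succ (Var 0)))
                         (Succ (Plus (Var 1) (Var 0))))))
| pa_mult_zero : PA_Box (All (Eq (Mult (Var 0) Zero) Zero))
| pa_mult_succ :
    PA_Box (All (All (Eq (Mult (Var 1) (Succ (Var 0)))
                         (Plus (Mult (Var 1) (Var 0)) (Var 1)))))
| pa_le :
    PA_Box (All (All (Iff (Le (Var 1) (Var 0))
                          (Ex (Eq (Plus (Var 2) (Var 0)) (Var 1))))))
(* phi(S x), for x the bound variable itself, is obtained by sending variable 0
   to [Succ (Var 0)] and leaving the parameters untouched. *)
| pa_ind phi :
    PA_Box
      (uclosure
         (Imp (inst Zero phi)
              (Imp (All (Imp phi (subst (scons (Succ (Var 0)) shift) phi)))
                   (All phi)))).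

Inductive PA_K : form -> Prop :=
| pak_pa a : PA_Box a -> PA_K a
| pak_K phi psi :
    PA_K (uclosure (Imp (Box (Imp phi psi)) (Imp (Box phi) (Box psi)))).

Inductive PA_K4 : form -> Prop :=
| pak4_pak a : PA_K a -> PA_K4 a
| pak4_4 phi : PA_K4 (uclosure (Imp (Box phi) (Box (Box phi)))).

Inductive Delta0 : form -> Prop :=
| d0_eq s t : Delta0 (Eq s t)
| d0_le s t : Delta0 (Le s t)
| d0_bot : Delta0 Bot
| d0_and a b : Delta0 a -> Delta0 b -> Delta0 (And a b)
| d0_or a b : Delta0 a -> Delta0 b -> Delta0 (Or a b)
| d0_imp a b : Delta0 a -> Delta0 b -> Delta0 (Imp a b)
| d0_all_lt t a : Delta0 a -> Delta0 (AllLt t a)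
| d0_ex_lt t a : Delta0 a -> Delta0 (ExLt t a)
| d0_all_le t a : Delta0 a -> Delta0 (AllLe t a)
| d0_ex_le t a : Delta0 a -> Delta0 (ExLe t a).

(* A (possibly empty) block of existential quantifiers before a Delta_0 formula. *)
Inductive Sigma1 : form -> Prop :=
| s1_delta0 a : Delta0 a -> Sigma1 a
| s1_ex a : Sigma1 a -> Sigma1 (Ex a).

Inductive Sigma1_Box : form -> Prop :=
| sb_sigma1 a : Sigma1 a -> Sigma1_Box a
| sb_box a : Sigma1_Box (Box a)
| sb_and a b : Sigma1_Box a -> Sigma1_Box b -> Sigma1_Box (And a b)
| sb_or a b : Sigma1_Box a -> Sigma1_Box b -> Sigma1_Box (Or a b)
| sb_ex a : Sigma1_Box a -> Sigma1_Box (Ex a)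
| sb_all_lt t a : Sigma1_Box a -> Sigma1_Box (AllLt t a).

(* Main.v *)
Require Import Defs.
From Stdlib Require Import List Arith Lia.
Import ListNotations.

(** Call [a] persistent when PA(K4) proves [a -> Box a].  Persistence is preserved
    by conjunction, disjunction and existential quantification, and [Box a] is
    persistent by the axiom 4.  Equations, inequalities and their negations are
    persistent by a double induction on the two sides.  Since [s = t -> Box (s = t)],
    equals can be replaced even inside [Box]; with this, [forall x < y, a]
    is seen to be persistent by induction on [y], splitting [forall x < S y, a]
    into [forall x < y, a] and [a(y)].  For Delta_0 formulas the negation has to be
    carried along, because of implications. *)

(** * Substitution *)

(** Agreement below the bound is all that matters; this later allows a substitution to be altered on
    variables that do not occur. *)
Lemma tsubst_ext_bound t (sigma tau : nat -> term) :
  (forall n, n < tbound t -> sigma n = tau n) ->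
  tsubst sigma t = tsubst tau t.
Proof.
  induction t; simpl; intros H; f_equal; auto;
    (apply IHt1 || apply IHt2 || apply H); intros; try apply H; lia.
Qed.

Lemma subst_ext_bound a : forall sigma tau : nat -> term,
  (forall n, n < bound a -> sigma n = tau n) -> subst sigma a = subst tau a.
Proof.
  induction a; simpl; intros sigma tau H; f_equal; try reflexivity;
    try (apply tsubst_ext_bound; intros; apply H; lia);
    try (apply IHa1; intros; apply H; lia);
    try (apply IHa2; intros; apply H; lia);
    try (apply IHa; intros; apply H; lia).
  all: apply IHa; intros [|n] Hn; simpl; [reflexivity|];
    rewrite (H n) by lia; reflexivity.
Qed.

Lemma subst_ext (sigma tau : nat -> term) a :
  (forall n, sigma n = tau n) -> subst sigma a = subst tau a.
Proof. intros H; apply subst_ext_bound; auto. Qed.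

Lemma tsubst_Var t : tsubst Var t = t.
Proof. induction t; simpl; congruence. Qed.

Lemma subst_Var a : subst Var a = a.
Proof.
  induction a; simpl; rewrite ?tsubst_Var; try congruence;
    f_equal; rewrite <- IHa at 2; apply subst_ext; intros [|n]; reflexivity.
Qed.

Lemma subst_id (sigma : nat -> term) a :
  (forall n, sigma n = Var n) -> subst sigma a = a.
Proof. intros H; rewrite <- (subst_Var a) at 2; apply subst_ext; exact H. Qed.

Lemma tsubst_comp (sigma tau : nat -> term) t :
  tsubst sigma (tsubst tau t) = tsubst (fun n => tsubst sigma (tau n)) t.
Proof. induction t; simpl; congruence. Qed.

Lemma tsubst_up_tlift (sigma : nat -> term) t :
  tsubst (up sigma) (tlift t) = tlift (tsubst sigma t).
Proof. unfold tlift; rewrite !tsubst_comp; reflexivity. Qed.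

Lemma up_comp (sigma tau : nat -> term) n :
  tsubst (up sigma) (up tau n) = up (fun m => tsubst sigma (tau m)) n.
Proof. destruct n; [reflexivity|apply tsubst_up_tlift]. Qed.

Lemma subst_comp a : forall sigma tau : nat -> term,
  subst sigma (subst tau a) = subst (fun n => tsubst sigma (tau n)) a.
Proof.
  induction a; intros; simpl; rewrite ?tsubst_comp, ?IHa1, ?IHa2, ?IHa;
    try reflexivity; f_equal; apply subst_ext; intros; apply up_comp.
Qed.

Lemma tsubst_scons_tlift t (sigma : nat -> term) u :
  tsubst (scons t sigma) (tlift u) = tsubst sigma u.
Proof. unfold tlift; rewrite tsubst_comp; reflexivity. Qed.

(** Lets successive instantiations of a quantifier prefix accumulate into one simultaneous
    substitution. *)
Lemma inst_subst_up t (sigma : nat -> term) a :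
  inst t (subst (up sigma) a) = subst (scons t sigma) a.
Proof.
  unfold inst; rewrite subst_comp; apply subst_ext; intros [|n]; simpl;
    [reflexivity|].
  change (tsubst shift (sigma n)) with (tlift (sigma n)).
  rewrite tsubst_scons_tlift; apply tsubst_Var.
Qed.

(** [subst (up shift) a] is the body of a lifted quantified formula; instantiated at the newest
    variable, it gives back the original body. *)
Lemma inst_up_shift a : inst (Var 0) (subst (up shift) a) = a.
Proof. rewrite inst_subst_up; apply subst_id; intros [|n]; reflexivity. Qed.

(** * Universal closures and their instances *)

Notation prov a := (proves PA_K4 a).

(* The outermost of the [k] quantifiers binds variable [k-1] of [a]; removing the
   prefix lowers the remaining variables by [k]. *)
Lemma prov_iter_All k : forall a (sigma : nat -> term),
  (forall n, k <= n -> sigma n = Var (n - k)) ->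
  prov (Nat.iter k All a) -> prov (subst sigma a).
Proof.
  induction k as [|k IH]; intros a sigma Hs H.
  - rewrite subst_id; [exact H|].
    intros n; rewrite Hs by lia; f_equal; lia.
  - rewrite Nat.iter_succ_r in H.
    (* The innermost quantifier binds variable 0: the [k] outer ones receive the tail of [sigma],
       and the last instantiation supplies [sigma 0]. *)
    apply (IH _ (fun n => sigma (S n))) in H.
    2: { intros n Hn; rewrite Hs by lia; f_equal. }
    simpl in H.
    apply (pr_mp _ _ _ (pr_logic _ _ (ax_all_e _ (sigma 0)))) in H.
    rewrite inst_subst_up in H.
    erewrite subst_ext; [exact H|]; intros [|n]; reflexivity.
Qed.

Lemma prov_uclosure a (sigma : nat -> term) :
  prov (uclosure a) -> prov (subst sigma a).
Proof.
  intros H.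
  (* Stripping the prefix forces the values from [bound a] on; [sigma] may be replaced by them
     there, since those variables do not occur in [a]. *)
  set (tau := fun n =>
    if n <? bound a then sigma n else Var (n - bound a)).
  rewrite (subst_ext_bound a sigma tau).
  - apply (prov_iter_All (bound a)); [|exact H].
    intros n Hn; unfold tau.
    destruct (Nat.ltb_spec n (bound a)); [lia|reflexivity].
  - intros n Hn; unfold tau.
    destruct (Nat.ltb_spec n (bound a)); [reflexivity|lia].
Qed.

Lemma prov_uclosure_elim a : prov (uclosure a) -> prov a.
Proof.
  intros H; apply (prov_uclosure a Var) in H; rewrite subst_Var in H; exact H.
Qed.

(** Generalize [bound a] times, then instantiate the closure; no induction on derivations is
    needed. *)
Lemma prov_subst a (sigma : nat -> term) : prov a -> prov (subst sigma a).
Proof.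
  intros H; apply prov_uclosure; unfold uclosure.
  induction (bound a); simpl; [exact H|apply pr_gen; assumption].
Qed.

(** * Natural deduction *)

(* The head of the context is the innermost antecedent, so that
   [der (h :: G) a] and [der G (Imp h a)] are convertible. *)
Fixpoint imps (G : list form) (a : form) : form :=
  match G with
  | [] => a
  | h :: G' => imps G' (Imp h a)
  end.

Notation der G a := (prov (imps G a)).

Lemma der_prov G : forall a, prov a -> der G a.
Proof.
  induction G as [|h G IH]; intros a H; simpl; [exact H|].
  apply IH; exact (pr_mp _ _ _ (pr_logic _ _ (ax_K _ _)) H).
Qed.

Lemma der_logic G a : logical_axiom a -> der G a.
Proof. intros H; apply der_prov, pr_logic, H. Qed.

Lemma der_mp G : forall a b, der G (Imp a b) -> der G a -> der G b.
Proof.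
  induction G as [|h G IH]; intros a b H1 H2; simpl in *.
  - exact (pr_mp _ _ _ H1 H2).
  - apply (IH (Imp h a)); [|exact H2].
    apply (IH (Imp h (Imp a b))); [|exact H1].
    apply der_logic, ax_S.
Qed.

Lemma der_logic1 G a b : logical_axiom (Imp a b) -> der G a -> der G b.
Proof. intros H; apply der_mp, der_logic, H. Qed.

Lemma der_logic2 G a b c :
  logical_axiom (Imp a (Imp b c)) -> der G a -> der G b -> der G c.
Proof. intros H Ha; apply der_mp, (der_logic1 _ _ _ H Ha). Qed.

Lemma der_weak h G a : der G a -> der (h :: G) a.
Proof. exact (der_logic1 G _ _ (ax_K a h)). Qed.

Lemma der_hyp G : forall a, In a G -> der G a.
Proof.
  induction G as [|h G IH]; intros a [].
  - subst h; simpl.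
    apply (der_logic2 _ _ _ _ (ax_S a (Imp a a) a)); apply der_logic, ax_K.
  - apply der_weak; auto.
Qed.

(** Simultaneous cut, which also serves as weakening, exchange and contraction of contexts. *)
Lemma der_cuts G' : forall G a,
  der G' a -> (forall h, In h G' -> der G h) -> der G a.
Proof.
  induction G' as [|h G' IH]; intros G a H HG; simpl in *.
  - apply der_prov, H.
  - apply (der_mp _ h); [apply IH|]; auto.
Qed.

Lemma der_imp_mono G a b : prov (Imp a b) -> der G a -> der G b.
Proof. intros H; apply der_mp, der_prov, H. Qed.

Lemma der_and G a b : der G a -> der G b -> der G (And a b).
Proof. exact (der_logic2 _ _ _ _ (ax_and_i a b)). Qed.

Lemma der_fst G a b : der G (And a b) -> der G a.
Proof. exact (der_logic1 _ _ _ (ax_and_l a b)). Qed.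

Lemma der_snd G a b : der G (And a b) -> der G b.
Proof. exact (der_logic1 _ _ _ (ax_and_r a b)). Qed.

Lemma der_inl G a b : der G a -> der G (Or a b).
Proof. exact (der_logic1 _ _ _ (ax_or_l a b)). Qed.

Lemma der_inr G a b : der G b -> der G (Or a b).
Proof. exact (der_logic1 _ _ _ (ax_or_r a b)). Qed.

Lemma der_or_elim G a b c :
  der G (Or a b) -> der (a :: G) c -> der (b :: G) c -> der G c.
Proof.
  intros H Ha Hb; apply (der_mp _ (Or a b)); [|exact H].
  exact (der_logic2 _ _ _ _ (ax_or_e a b c) Ha Hb).
Qed.

Lemma der_absurd G a b : der G (Neg a) -> der G a -> der G b.
Proof.
  intros Hn Ha; apply (der_logic1 _ _ _ (ax_bot b)); exact (der_mp _ _ _ Hn Ha).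
Qed.

Lemma der_contra G a : der (Neg a :: G) Bot -> der G a.
Proof. exact (der_logic1 G _ _ (ax_dne a)). Qed.

Lemma der_em G a : der G (Or a (Neg a)).
Proof.
  apply der_contra.
  apply (der_mp _ (Or a (Neg a))); [apply der_hyp; simpl; auto|].
  apply der_inr.
  change (der (a :: Neg (Or a (Neg a)) :: G) Bot).
  apply (der_mp _ (Or a (Neg a))); [apply der_hyp; simpl; auto|].
  apply der_inl, der_hyp; simpl; auto.
Qed.

(** Lifting the context expresses the eigenvariable condition; [ax_all_i] moves the hypotheses out
    of the quantifier one at a time. *)
Lemma der_all_intro G : forall a, der (map lift G) a -> der G (All a).
Proof.
  induction G as [|h G IH]; intros a H; simpl in *.
  - apply pr_gen, H.
  - exact (der_logic1 _ _ _ (ax_all_i h a) (IH _ H)).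
Qed.

Lemma der_inst G a t : der G (All a) -> der G (inst t a).
Proof. exact (der_logic1 _ _ _ (ax_all_e a t)). Qed.

Lemma der_lift_all G a : der G (lift (All a)) -> der G a.
Proof.
  intros H; rewrite <- (inst_up_shift a); exact (der_inst _ _ (Var 0) H).
Qed.

Lemma der_ex_intro t G a : der G (inst t a) -> der G (Ex a).
Proof. exact (der_logic1 _ _ _ (ax_ex_i a t)). Qed.

Lemma der_lift_ex G a : der G a -> der G (lift (Ex a)).
Proof.
  intros H; apply (der_ex_intro (Var 0)).
  change (der G (inst (Var 0) (subst (up shift) a))).
  rewrite inst_up_shift; exact H.
Qed.

Lemma der_ex_elim G a b :
  der G (Ex a) -> der (a :: map lift G) (lift b) -> der G b.
Proof.
  intros He H; apply (der_logic2 _ _ _ _ (ax_ex_e a b)); [|exact He].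
  apply der_all_intro, H.
Qed.

(** * Reasoning under the modality *)

Lemma der_box_mp G a b :
  der G (Box (Imp a b)) -> der G (Box a) -> der G (Box b).
Proof.
  intros H; apply der_mp; revert H; apply der_imp_mono.
  apply prov_uclosure_elim, pr_ax, pak4_pak, pak_K.
Qed.

(** Necessitation applies to theorems only, so the whole implication with antecedents [G'] is boxed,
    and K then discharges the antecedents one by one. *)
Lemma der_box G' : forall G a,
  der G' a -> (forall h, In h G' -> der G (Box h)) -> der G (Box a).
Proof.
  induction G' as [|h G' IH]; intros G a H HG; simpl in *.
  - apply der_prov, pr_nec, H.
  - apply (der_box_mp _ h); [apply IH|]; auto.
Qed.

Arguments imps : simpl never.

Ltac hyp :=
  apply der_hyp; solve [repeat first [left; reflexivity | right]].

(** * Elementary arithmetic *)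

Lemma prov_ind phi :
  prov (inst Zero phi) ->
  der [phi] (subst (scons (Succ (Var 0)) shift) phi) ->
  prov phi.
Proof.
  intros H0 HS; rewrite <- (inst_up_shift phi).
  apply (der_inst []), (prov_subst (All phi)).
  refine (pr_mp _ _ _ (pr_mp _ _ _ _ H0) (pr_gen _ _ HS)).
  apply prov_uclosure_elim, pr_ax, pak4_pak, pak_pa, pa_ind.
Qed.

Lemma prov_cases phi :
  prov (inst Zero phi) -> prov (subst (scons (Succ (Var 0)) shift) phi) ->
  prov phi.
Proof. intros H0 HS; apply prov_ind; [exact H0|apply der_prov, HS]. Qed.

Lemma der_refl G t : der G (Eq t t).
Proof. apply der_logic, ax_eq_refl. Qed.

Lemma der_sym G s t : der G (Eq s t) -> der G (Eq t s).
Proof.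
  intros H; apply (der_mp _ (Eq s s)); [|apply der_refl].
  apply (der_logic2 _ _ _ _ (ax_eq_eq s t s s) H), der_refl.
Qed.

Lemma der_trans t G s u : der G (Eq s t) -> der G (Eq t u) -> der G (Eq s u).
Proof.
  intros H H'; apply (der_mp _ (Eq s t)); [|exact H].
  exact (der_logic2 _ _ _ _ (ax_eq_eq s s t u) (der_refl _ _) H').
Qed.

Lemma der_succ G s t : der G (Eq s t) -> der G (Eq (Succ s) (Succ t)).
Proof. exact (der_logic1 _ _ _ (ax_eq_succ s t)). Qed.

Lemma der_plus G s s' t t' :
  der G (Eq s s') -> der G (Eq t t') -> der G (Eq (Plus s t) (Plus s' t')).
Proof. exact (der_logic2 _ _ _ _ (ax_eq_plus s s' t t')). Qed.

Lemma prov_pa a : PA_Box a -> prov a.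
Proof. intros H; apply pr_ax, pak4_pak, pak_pa, H. Qed.

Lemma prov_inst2 a s t : prov (All (All a)) -> prov (subst (scons t (scons s Var)) a).
Proof.
  intros H.
  apply (der_inst [] _ s) in H; apply (der_inst [] _ t) in H.
  rewrite inst_subst_up in H; exact H.
Qed.

Lemma der_succ_neq_zero G t b : der G (Eq (Succ t) Zero) -> der G b.
Proof.
  apply der_absurd, der_prov.
  exact (der_inst [] _ t (prov_pa _ pa_succ_neq_zero)).
Qed.

Lemma der_succ_inj G s t : der G (Eq (Succ s) (Succ t)) -> der G (Eq s t).
Proof.
  apply der_imp_mono; exact (prov_inst2 _ s t (prov_pa _ pa_succ_inj)).
Qed.

Lemma der_plus_zero G t : der G (Eq (Plus t Zero) t).
Proof. apply der_prov; exact (der_inst [] _ t (prov_pa _ pa_plus_zero)). Qed.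

Lemma der_plus_succ G s t :
  der G (Eq (Plus s (Succ t)) (Succ (Plus s t))).
Proof.
  apply der_prov; exact (prov_inst2 _ s t (prov_pa _ pa_plus_succ)).
Qed.

Lemma der_zero_plus G t : der G (Eq (Plus Zero t) t).
Proof.
  apply der_prov.
  (* Induction runs on a variable, so the law is proved for [Var 0] and then instantiated. *)
  apply (prov_subst (Eq (Plus Zero (Var 0)) (Var 0)) (scons t Var)).
  apply prov_ind.
  - exact (der_plus_zero [] Zero).
  - unfold subst, tsubst, scons.
    eapply der_trans; [apply der_plus_succ|].
    apply der_succ; hyp.
Qed.

Lemma der_succ_plus G s t :
  der G (Eq (Plus (Succ s) t) (Succ (Plus s t))).
Proof.
  apply der_prov.
  apply (prov_subst (Eq (Plus (Succ (Var 1)) (Var 0))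
                        (Succ (Plus (Var 1) (Var 0))))
           (scons t (scons s Var))).
  apply prov_ind.
  - unfold inst, subst, tsubst, scons.
    apply (der_trans (Succ (Var 0)) []); [apply der_plus_zero|].
    apply der_sym, der_succ, der_plus_zero.
  - unfold subst, tsubst, scons, shift.
    eapply der_trans; [apply der_plus_succ|].
    apply der_succ.
    eapply der_trans; [hyp|].
    apply der_sym, der_plus_succ.
Qed.

Lemma prov_le s t :
  prov (Iff (Le s t) (Ex (Eq (Plus (tlift s) (Var 0)) (tlift t)))).
Proof. exact (prov_inst2 _ s t (prov_pa _ pa_le)). Qed.

Lemma der_le_intro r G s t : der G (Eq (Plus s r) t) -> der G (Le s t).
Proof.
  intros H.
  apply (der_imp_mono _ _ _ (der_snd [] _ _ (prov_le s t))).
  apply (der_ex_intro r); unfold inst; simpl.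
  rewrite !tsubst_scons_tlift, !tsubst_Var; exact H.
Qed.

(** The fresh variable names the difference of [t] and [s]. *)
Lemma der_le_elim G s t b :
  der G (Le s t) ->
  der (Eq (Plus (tlift s) (Var 0)) (tlift t) :: map lift G) (lift b) ->
  der G b.
Proof.
  intros H; apply der_ex_elim; revert H.
  exact (der_imp_mono _ _ _ (der_fst [] _ _ (prov_le s t))).
Qed.

Lemma der_zero_or_succ G t :
  der G (Or (Eq t Zero) (Ex (Eq (tlift t) (Succ (Var 0))))).
Proof.
  apply der_prov.
  apply (prov_subst (Or (Eq (Var 0) Zero) (Ex (Eq (Var 1) (Succ (Var 0)))))
    (scons t Var)).
  apply prov_cases.
  - apply (der_inl []), (der_refl [] Zero).
  - apply (der_inr []), (der_ex_intro (Var 0) []).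
    exact (der_refl [] (Succ (Var 0))).
Qed.

Lemma der_case t G a :
  der (Eq t Zero :: G) a ->
  der (Eq (tlift t) (Succ (Var 0)) :: map lift G) (lift a) ->
  der G a.
Proof.
  intros H0 HS; apply (der_or_elim _ _ _ _ (der_zero_or_succ G t) H0).
  eapply der_ex_elim; [hyp|].
  apply (der_cuts _ _ _ HS).
  intros h [<-|Hh]; apply der_hyp; simpl; auto.
Qed.

Lemma der_le_zero G t b : der G (Le (Succ t) Zero) -> der G b.
Proof.
  intros H; apply (der_le_elim _ _ _ _ H); simpl.
  apply (der_succ_neq_zero _ (Plus (tlift t) (Var 0))).
  apply (der_trans (Plus (Succ (tlift t)) (Var 0))); [|hyp].
  apply der_sym, der_succ_plus.
Qed.

Lemma der_zero_le G t : der G (Le Zero t).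
Proof. apply (der_le_intro t), der_zero_plus. Qed.

Lemma der_le_succ G s t : der G (Le s t) -> der G (Le (Succ s) (Succ t)).
Proof.
  intros H; apply (der_le_elim _ _ _ _ H); simpl.
  apply (der_le_intro (Var 0)).
  eapply der_trans; [apply der_succ_plus|].
  apply der_succ; hyp.
Qed.

Lemma der_le_succ_inv G s t : der G (Le (Succ s) (Succ t)) -> der G (Le s t).
Proof.
  intros H; apply (der_le_elim _ _ _ _ H); simpl.
  apply (der_le_intro (Var 0)).
  apply der_succ_inj.
  eapply der_trans; [apply der_sym, der_succ_plus|hyp].
Qed.

Lemma der_lt_succ_diag G t : der G (Lt t (Succ t)).
Proof. apply (der_le_intro Zero), der_plus_zero. Qed.

Lemma der_le_succ_r G s t : der G (Le s t) -> der G (Le s (Succ t)).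
Proof.
  intros H; apply (der_le_elim _ _ _ _ H); simpl.
  apply (der_le_intro (Succ (Var 0))).
  eapply der_trans; [apply der_plus_succ|].
  apply der_succ; hyp.
Qed.

(** Case split on the difference of [t] and [s]: zero gives equality, a successor gives strict
    inequality. *)
Lemma der_lt_succ G s t :
  der G (Lt s (Succ t)) -> der G (Or (Lt s t) (Eq s t)).
Proof.
  intros H; apply der_le_succ_inv in H.
  apply (der_le_elim _ _ _ _ H).
  apply (der_case (Var 0)); simpl.
  - apply der_inr.
    apply (der_trans (Plus (tlift s) (Var 0))); [|hyp].
    apply (der_trans (Plus (tlift s) Zero)); [apply der_sym, der_plus_zero|].
    apply der_plus; [apply der_refl|apply der_sym; hyp].
  - apply der_inl, (der_le_intro (Var 0)).
    apply (der_trans (Plus (tlift (tlift s)) (Var 1))); [|hyp].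
    apply (der_trans (Plus (tlift (tlift s)) (Succ (Var 0)))).
    + eapply der_trans; [apply der_succ_plus|].
      apply der_sym, der_plus_succ.
    + apply der_plus; [apply der_refl|apply der_sym; hyp].
Qed.

(** * Formulas that imply their own necessitation *)

Definition persistent (a : form) : Prop := prov (Imp a (Box a)).

Lemma persistent_subst a (sigma : nat -> term) :
  persistent a -> persistent (subst sigma a).
Proof. exact (prov_subst _ sigma). Qed.

Lemma der_persistent G a : persistent a -> der G a -> der G (Box a).
Proof. apply der_imp_mono. Qed.

(** A derivation from persistent hypotheses can be carried out under [Box], as each hypothesis
    yields its own boxed form. *)
Lemma der_box_persistent G a :
  (forall h, In h G -> persistent h) -> der G a -> der G (Box a).
Proof.
  intros HG H; apply (der_box G); [exact H|].
  intros h Hh; apply der_persistent; [auto|apply der_hyp, Hh].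
Qed.

Lemma persistent_prov a : prov a -> persistent a.
Proof. intros H; apply (der_prov [a]), pr_nec, H. Qed.

Lemma prov_imp_box a b :
  persistent a -> der [a] b -> prov (Imp a (Box b)).
Proof.
  intros Ha H; apply (der_box_persistent [a]); [|exact H]; intros h [<-|[]]; exact Ha.
Qed.

(** From [b] one gets [a], hence [Box a]; the implication back to [b] is a theorem, so it may be
    used under [Box]. *)
Lemma persistent_equiv a b :
  persistent a -> der [a] b -> der [b] a -> persistent b.
Proof.
  intros Ha Hab Hba.
  exact (der_imp_mono [b] _ _ (prov_imp_box _ _ Ha Hab) Hba).
Qed.

Lemma persistent_and a b :
  persistent a -> persistent b -> persistent (And a b).
Proof.
  intros Ha Hb; apply (der_cuts [a; b] [And a b]).
  - apply der_box_persistent.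
    + intros h [<-|[<-|[]]]; assumption.
    + apply der_and; hyp.
  - intros h [<-|[<-|[]]]; [eapply der_fst|eapply der_snd]; hyp.
Qed.

Lemma persistent_or a b :
  persistent a -> persistent b -> persistent (Or a b).
Proof.
  intros Ha Hb; apply (der_or_elim [Or a b] a b); [hyp| |].
  - apply (der_imp_mono _ a); [|hyp].
    apply prov_imp_box; [exact Ha|apply der_inl; hyp].
  - apply (der_imp_mono _ b); [|hyp].
    apply prov_imp_box; [exact Hb|apply der_inr; hyp].
Qed.

(** For a given witness, [Box a] yields [Box (Ex a)] because [a] implies [Ex a] provably; the
    witness no longer occurs in that conclusion and can be eliminated. *)
Lemma persistent_ex a : persistent a -> persistent (Ex a).
Proof.
  intros Ha; apply (der_ex_elim [Ex a] a (Box (Ex a))); [hyp|].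
  simpl; apply (der_imp_mono _ a); [|hyp].
  apply prov_imp_box; [exact Ha|].
  apply (der_ex_intro (Var 0)); rewrite inst_up_shift; hyp.
Qed.

(** * Atomic formulas and their negations *)

(** Induction on the first argument with the second quantified; in the step, a case split on the
    second argument suffices. The first hypothesis makes [f] behave as a formula with two argument
    places. *)
Lemma prov_double_ind (f : term -> term -> form) :
  (forall sigma s t, subst sigma (f s t) = f (tsubst sigma s) (tsubst sigma t)) ->
  prov (f Zero Zero) ->
  (forall t, prov (f Zero (Succ t))) ->
  (forall s, prov (f (Succ s) Zero)) ->
  (forall s t, prov (Imp (f s t) (f (Succ s) (Succ t)))) ->
  forall s t, prov (f s t).
Proof.
  intros Hf H00 H0S HS0 HSS s t.
  assert (H : prov (All (f (Var 1) (Var 0)))).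
  - apply prov_ind; unfold inst; simpl; rewrite !Hf; simpl.
    + apply pr_gen, prov_cases; unfold inst; rewrite Hf; simpl; auto.
    + apply (der_all_intro [All _]); unfold lift; simpl; rewrite Hf; simpl.
      (* The induction hypothesis keeps its quantifier during the case split, so that it can be used
         at the predecessor. *)
      change (prov (Imp (All (f (Var 2) (Var 0))) (f (Succ (Var 1)) (Var 0)))).
      apply prov_cases; unfold inst; simpl; rewrite !Hf; simpl.
      * apply (der_prov [_]), HS0.
      * apply (der_imp_mono [All _] (f (Var 1) (Var 0))); [apply HSS|].
        replace (f (Var 1) (Var 0)) with (inst (Var 0) (f (Var 2) (Var 0)))
          by apply Hf.
        apply der_inst; hyp.
  - pose proof (prov_inst2 _ s t (pr_gen _ _ H)) as H'.
    rewrite Hf in H'; exact H'.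
Qed.

(** [Eq Zero Zero] is a theorem and the mixed cases are refutable. For two successors, injectivity
    leads down to [Box (Eq s t)], and congruence under [Box] leads up again. *)
Lemma persistent_eq s t : persistent (Eq s t).
Proof.
  apply (prov_double_ind (fun s t => Imp (Eq s t) (Box (Eq s t))));
    clear; [reflexivity| | | |].
  - apply persistent_prov, (der_refl []).
  - intros t; apply (der_succ_neq_zero [_] t), der_sym; hyp.
  - intros s; apply (der_succ_neq_zero [_] s); hyp.
  - intros s t; set (p := Imp (Eq s t) (Box (Eq s t))).
    apply (der_box [Eq s t] [Eq (Succ s) (Succ t); p]).
    + apply der_succ; hyp.
    + intros h [<-|[]]; apply (der_mp _ (Eq s t)); [hyp|].
      apply der_succ_inj; hyp.
Qed.

Lemma der_neg_map G a b : der [a] b -> der G (Neg b) -> der G (Neg a).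
Proof.
  intros H Hb; change (der (a :: G) Bot).
  apply (der_mp _ b); [apply der_weak, Hb|].
  apply (der_imp_mono _ a); [exact H|hyp].
Qed.

(** The base cases trade places: [Eq Zero Zero] makes the antecedent absurd, and the mixed
    inequations are theorems. *)
Lemma persistent_neq s t : persistent (Neg (Eq s t)).
Proof.
  apply (prov_double_ind (fun s t => Imp (Neg (Eq s t)) (Box (Neg (Eq s t)))));
    clear; [reflexivity| | | |].
  - apply (der_absurd [_] (Eq Zero Zero)); [hyp|apply der_refl].
  - intros t; apply persistent_prov, (der_succ_neq_zero [_] t), der_sym; hyp.
  - intros s; apply persistent_prov, (der_succ_neq_zero [_] s); hyp.
  - intros s t; set (p := Imp (Neg (Eq s t)) (Box (Neg (Eq s t)))).
    apply (der_box [Neg (Eq s t)] [Neg (Eq (Succ s) (Succ t)); p]).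
    + apply (der_neg_map _ _ (Eq s t)); [apply der_succ_inj; hyp|hyp].
    + intros h [<-|[]]; apply (der_mp _ (Neg (Eq s t))); [hyp|].
      apply (der_neg_map _ _ (Eq (Succ s) (Succ t))); [apply der_succ; hyp|hyp].
Qed.

Lemma persistent_le s t : persistent (Le s t).
Proof.
  apply (persistent_equiv (Ex (Eq (Plus (tlift s) (Var 0)) (tlift t)))).
  - apply persistent_ex, persistent_eq.
  - exact (der_snd [] _ _ (prov_le s t)).
  - exact (der_fst [] _ _ (prov_le s t)).
Qed.

(** Unlike [Le], its negation is not an existential statement about equations, so the double
    induction is repeated. *)
Lemma persistent_nle s t : persistent (Neg (Le s t)).
Proof.
  apply (prov_double_ind (fun s t => Imp (Neg (Le s t)) (Box (Neg (Le s t)))));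
    clear; [reflexivity| | | |].
  - apply (der_absurd [_] (Le Zero Zero)); [hyp|apply der_zero_le].
  - intros t; apply (der_absurd [_] (Le Zero (Succ t))); [hyp|apply der_zero_le].
  - intros s; apply persistent_prov, (der_le_zero [_] s); hyp.
  - intros s t; set (p := Imp (Neg (Le s t)) (Box (Neg (Le s t)))).
    apply (der_box [Neg (Le s t)] [Neg (Le (Succ s) (Succ t)); p]).
    + apply (der_neg_map _ _ (Le s t)); [apply der_le_succ_inv; hyp|hyp].
    + intros h [<-|[]]; apply (der_mp _ (Neg (Le s t))); [hyp|].
      apply (der_neg_map _ _ (Le (Succ s) (Succ t))); [apply der_le_succ; hyp|hyp].
Qed.

(** * Replacement of equals in arbitrary formulas *)

Lemma der_eq_up s t (sigma tau : nat -> term) n :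
  (forall m, der [Eq s t] (Eq (sigma m) (tau m))) ->
  der [Eq (tlift s) (tlift t)] (Eq (up sigma n) (up tau n)).
Proof.
  intros H; destruct n as [|n]; [apply der_refl|].
  exact (prov_subst _ shift (H n)).
Qed.

Lemma der_eq_tsubst G (sigma tau : nat -> term) u :
  (forall n, der G (Eq (sigma n) (tau n))) ->
  der G (Eq (tsubst sigma u) (tsubst tau u)).
Proof.
  intros H; induction u; simpl; auto.
  - apply der_refl.
  - apply der_succ; assumption.
  - apply der_plus; assumption.
  - exact (der_logic2 _ _ _ _ (ax_eq_mult _ _ _ _) IHu1 IHu2).
Qed.

(** All pointwise equations are required to follow from the single equation [Eq s t]. In the [Box]
    case only this one hypothesis has to be boxed, and it is persistent. Arbitrary substitutions are
    needed to pass binders. *)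
Lemma der_eq_subst s t a : forall sigma tau : nat -> term,
  (forall n, der [Eq s t] (Eq (sigma n) (tau n))) ->
  der [subst sigma a; Eq s t] (subst tau a).
Proof.
  revert s t; induction a as [u v|u v| |a IHa b IHb|a IHa b IHb|a IHa b IHb
    |a IHa|a IHa|a IHa]; intros s t sigma tau H; simpl subst.
  - exact (der_logic2 _ _ _ _ (ax_eq_eq _ _ _ _)
      (der_eq_tsubst _ _ _ u H) (der_eq_tsubst _ _ _ v H)).
  - exact (der_logic2 _ _ _ _ (ax_eq_le _ _ _ _)
      (der_eq_tsubst _ _ _ u H) (der_eq_tsubst _ _ _ v H)).
  - hyp.
  - apply der_and;
      [apply (der_cuts _ _ _ (IHa _ _ _ _ H))|apply (der_cuts _ _ _ (IHb _ _ _ _ H))];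
      intros h [<-|[<-|[]]]; try hyp; [eapply der_fst|eapply der_snd]; hyp.
  - eapply der_or_elim; [hyp| |]; [apply der_inl|apply der_inr];
      [apply (der_cuts _ _ _ (IHa _ _ _ _ H))|apply (der_cuts _ _ _ (IHb _ _ _ _ H))];
      intros h [<-|[<-|[]]]; hyp.
  - change (der [subst tau a; Imp (subst sigma a) (subst sigma b); Eq s t]
                (subst tau b)).
    (* An antecedent is transported backwards, from [tau] to [sigma]. *)
    assert (H' : forall n, der [Eq s t] (Eq (tau n) (sigma n)))
      by (intros n; apply der_sym, H).
    apply (der_cuts _ _ _ (IHb _ _ _ _ H)).
    intros h [<-|[<-|[]]]; [|hyp].
    apply (der_mp _ (subst sigma a)); [hyp|].
    apply (der_cuts _ _ _ (IHa _ _ _ _ H')).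
    intros h [<-|[<-|[]]]; hyp.
  - apply der_all_intro; simpl.
    apply (der_cuts _ _ _ (IHa _ _ _ _ (fun n => der_eq_up s t sigma tau n H))).
    intros h [<-|[<-|[]]]; [|hyp].
    apply der_lift_all; hyp.
  - eapply der_ex_elim; [hyp|]; simpl.
    apply der_lift_ex.
    apply (der_cuts _ _ _ (IHa _ _ _ _ (fun n => der_eq_up s t sigma tau n H))).
    intros h [<-|[<-|[]]]; hyp.
  - apply (der_box _ _ _ (IHa _ _ _ _ H)).
    intros h [<-|[<-|[]]]; [hyp|].
    apply der_persistent; [apply persistent_eq|hyp].
Qed.

(** * Bounded quantifiers *)

Lemma der_alllt_elim s G t a :
  der G (AllLt t a) -> der G (Lt s t) -> der G (inst s a).
Proof.
  intros H; apply der_mp; apply (der_inst _ _ s) in H.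
  unfold inst in H; simpl in H.
  rewrite tsubst_scons_tlift, tsubst_Var in H; exact H.
Qed.

(** Presents the formula as an instance of one whose bound is a variable, on which induction is
    possible. *)
Lemma inst_alllt_Var0 t a :
  inst t (AllLt (Var 0) (subst (up shift) a)) = AllLt t a.
Proof.
  unfold inst, AllLt; simpl; rewrite subst_comp, subst_id; [reflexivity|].
  intros [|n]; reflexivity.
Qed.

Lemma persistent_alllt_succ a :
  persistent a ->
  der [Box (AllLt (Var 0) (subst (up shift) a));
       AllLt (Succ (Var 0)) (subst (up shift) a)]
    (Box (AllLt (Succ (Var 0)) (subst (up shift) a))).
Proof.
  intros Ha; set (b := subst (up shift) a).
  (* Outside the quantifier, variable 0 of [a] is the induction variable, so [a] itself is the
     instance at the new point. *)
  apply (der_box [AllLt (Var 0) b; a]).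
  - apply der_all_intro; simpl.
    change (der (Lt (Var 0) (Succ (Var 1)) :: map lift [AllLt (Var 0) b; a]) b).
    apply (der_or_elim _ (Lt (Var 0) (Var 1)) (Eq (Var 0) (Var 1)));
      [apply der_lt_succ; hyp| |].
    + apply (der_mp _ (Lt (Var 0) (Var 1))); [|hyp].
      apply der_lift_all; hyp.
    (* [lift a] and [b] apply [shift] and [up shift] to [a]; these differ only at 0, with values
       [Var 1] and [Var 0]. *)
    + apply (der_cuts [lift a; Eq (Var 1) (Var 0)]).
      * apply der_eq_subst; intros [|n]; [hyp|apply der_refl].
      * intros h [<-|[<-|[]]]; [hyp|apply der_sym; hyp].
  - intros h [<-|[<-|[]]]; [hyp|].
    apply der_persistent; [exact Ha|].
    rewrite <- (inst_up_shift a).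
    apply (der_alllt_elim _ _ (Succ (Var 0))); [hyp|apply der_lt_succ_diag].
Qed.

Lemma persistent_alllt t a : persistent a -> persistent (AllLt t a).
Proof.
  intros Ha.
  set (b := AllLt (Var 0) (subst (up shift) a)).
  rewrite <- (inst_alllt_Var0 t a).
  apply persistent_subst; fold b.
  apply prov_ind.
  (* With bound zero the quantifier is vacuous, so the formula is a theorem. *)
  - apply (persistent_prov (inst Zero b)); unfold b; rewrite inst_alllt_Var0.
    apply pr_gen, (der_le_zero [_] (Var 0)); hyp.
  - assert (E : subst (scons (Succ (Var 0)) shift) b
                = AllLt (Succ (Var 0)) (subst (up shift) a)).
    + unfold b, AllLt; simpl; rewrite subst_comp; do 2 f_equal.
      apply subst_ext; intros [|n]; reflexivity.
    + set (c := AllLt (Succ (Var 0)) (subst (up shift) a)).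
      change (der [subst (scons (Succ (Var 0)) shift) b; Imp b (Box b)]
        (Box (subst (scons (Succ (Var 0)) shift) b))).
      rewrite E; fold c.
      apply (der_cuts _ _ _ (persistent_alllt_succ a Ha)).
      intros h [<-|[<-|[]]]; [|hyp].
      (* The assumption up to the successor bound restricts to the smaller one, which triggers the
         induction hypothesis. *)
      apply (der_mp _ b); [hyp|].
      apply der_all_intro; simpl.
      change (der [Lt (Var 0) (Var 1); lift c; lift (Imp b (Box b))]
        (subst (up shift) a)).
      apply (der_mp _ (Lt (Var 0) (Succ (Var 1)))); [apply der_lift_all; hyp|].
      apply der_le_succ_r; hyp.
Qed.

Lemma persistent_allle t a : persistent a -> persistent (AllLe t a).
Proof.
  intros Ha; apply (persistent_equiv (AllLt (Succ t) a));
    [apply persistent_alllt, Ha| |]; apply der_all_intro; simpl.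
  - change (der [Le (Var 0) (tlift t); lift (AllLt (Succ t) a)] a).
    apply (der_mp _ (Lt (Var 0) (Succ (tlift t)))).
    + apply der_lift_all; hyp.
    + apply der_le_succ; hyp.
  - change (der [Lt (Var 0) (Succ (tlift t)); lift (AllLe t a)] a).
    apply (der_mp _ (Le (Var 0) (tlift t))).
    + apply der_lift_all; hyp.
    + apply der_le_succ_inv; hyp.
Qed.

(** Classically equivalent to [Ex (And b (Neg a))]; the guard [b] will be an inequality. *)
Lemma persistent_neg_all b a :
  persistent b -> persistent (Neg a) -> persistent (Neg (All (Imp b a))).
Proof.
  intros Hb Ha; apply (persistent_equiv (Ex (And b (Neg a)))).
  - apply persistent_ex, persistent_and; assumption.
  - change (der [All (Imp b a); Ex (And b (Neg a))] Bot).
    eapply der_ex_elim; [hyp|]; simpl.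
    apply (der_absurd _ a); [eapply der_snd; hyp|].
    apply (der_mp _ b); [|eapply der_fst; hyp].
    apply der_lift_all; hyp.
  - apply der_contra.
    apply (der_mp _ (All (Imp b a))); [hyp|].
    apply der_all_intro; simpl.
    change (der [b; lift (Neg (Ex (And b (Neg a)))); lift (Neg (All (Imp b a)))] a).
    apply der_contra.
    apply (der_mp _ (lift (Ex (And b (Neg a))))); [hyp|].
    apply der_lift_ex.
    apply der_and; hyp.
Qed.

(** Persistence is assumed of the whole universal formula, because only bounded universal
    quantifiers have been shown to preserve it. *)
Lemma persistent_neg_ex b a :
  persistent (All (Imp b (Neg a))) -> persistent (Neg (Ex (And b a))).
Proof.
  intros H; apply (persistent_equiv _ _ H).
  - change (der [Ex (And b a); All (Imp b (Neg a))] Bot).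
    eapply der_ex_elim; [hyp|]; simpl.
    apply (der_absurd _ a); [|eapply der_snd; hyp].
    apply (der_mp _ b); [|eapply der_fst; hyp].
    apply der_lift_all; hyp.
  - apply der_all_intro; simpl.
    change (der [a; b; lift (Neg (Ex (And b a)))] Bot).
    apply (der_mp _ (lift (Ex (And b a)))); [hyp|].
    apply der_lift_ex.
    apply der_and; hyp.
Qed.

(** * Propositional connectives under negation *)

(** Here and in the next lemmas, the formula is classically equivalent to a conjunction or
    disjunction of formulas assumed persistent. *)
Lemma persistent_imp a b :
  persistent (Neg a) -> persistent b -> persistent (Imp a b).
Proof.
  intros Ha Hb; apply (persistent_equiv (Or (Neg a) b)).
  - apply persistent_or; assumption.
  - change (der [a; Or (Neg a) b] b).
    eapply der_or_elim; [hyp| |hyp].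
    apply (der_absurd _ a); hyp.
  - apply (der_or_elim _ _ _ _ (der_em _ a)).
    + apply der_inr, (der_mp _ a); hyp.
    + apply der_inl; hyp.
Qed.

Lemma persistent_neg_imp a b :
  persistent a -> persistent (Neg b) -> persistent (Neg (Imp a b)).
Proof.
  intros Ha Hb; apply (persistent_equiv (And a (Neg b))).
  - apply persistent_and; assumption.
  - change (der [Imp a b; And a (Neg b)] Bot).
    apply (der_mp _ b); [eapply der_snd; hyp|].
    apply (der_mp _ a); [hyp|eapply der_fst; hyp].
  - apply der_and.
    + apply der_contra, (der_mp _ (Imp a b)); [hyp|].
      change (der [a; Neg a; Neg (Imp a b)] b).
      apply (der_absurd _ a); hyp.
    + change (der [b; Neg (Imp a b)] Bot).
      apply (der_mp _ (Imp a b)); [hyp|].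
      change (der [a; b; Neg (Imp a b)] b); hyp.
Qed.

Lemma persistent_neg_and a b :
  persistent (Neg a) -> persistent (Neg b) -> persistent (Neg (And a b)).
Proof.
  intros Ha Hb; apply (persistent_equiv (Or (Neg a) (Neg b))).
  - apply persistent_or; assumption.
  - eapply der_or_elim; [hyp| |];
      [apply (der_neg_map _ _ a)|apply (der_neg_map _ _ b)]; try hyp;
      [eapply der_fst|eapply der_snd]; hyp.
  - apply (der_or_elim _ _ _ _ (der_em _ a)); [|apply der_inl; hyp].
    apply der_inr.
    change (der [b; a; Neg (And a b)] Bot).
    apply (der_mp _ (And a b)); [hyp|apply der_and; hyp].
Qed.

Lemma persistent_neg_or a b :
  persistent (Neg a) -> persistent (Neg b) -> persistent (Neg (Or a b)).
Proof.
  intros Ha Hb; apply (persistent_equiv (And (Neg a) (Neg b))).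
  - apply persistent_and; assumption.
  - change (der [Or a b; And (Neg a) (Neg b)] Bot).
    eapply der_or_elim; [hyp| |];
      [apply (der_absurd _ a)|apply (der_absurd _ b)]; try hyp;
      [eapply der_fst|eapply der_snd]; hyp.
  - apply der_and;
      [apply (der_neg_map _ _ (Or a b))|apply (der_neg_map _ _ (Or a b))];
      try hyp; [apply der_inl|apply der_inr]; hyp.
Qed.

(** * Delta_0 formulas and the class Sigma_1(Box) *)

Lemma persistent_delta0 a : Delta0 a -> persistent a /\ persistent (Neg a).
Proof.
  induction 1 as [s t|s t| |a b _ [Ha Na] _ [Hb Nb]|a b _ [Ha Na] _ [Hb Nb]
    |a b _ [Ha Na] _ [Hb Nb]|t a _ [Ha Na]|t a _ [Ha Na]|t a _ [Ha Na]
    |t a _ [Ha Na]]; split.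
  - apply persistent_eq.
  - apply persistent_neq.
  - apply persistent_le.
  - apply persistent_nle.
  - apply pr_logic, ax_bot.
  - apply persistent_prov, (der_hyp [Bot]); simpl; auto.
  - apply persistent_and; assumption.
  - apply persistent_neg_and; assumption.
  - apply persistent_or; assumption.
  - apply persistent_neg_or; assumption.
  - apply persistent_imp; assumption.
  - apply persistent_neg_imp; assumption.
  - apply persistent_alllt, Ha.
  - apply persistent_neg_all; [apply persistent_le|exact Na].
  - apply persistent_ex, persistent_and; [apply persistent_le|exact Ha].
  - apply persistent_neg_ex, persistent_alllt, Na.
  - apply persistent_allle, Ha.
  - apply persistent_neg_all; [apply persistent_le|exact Na].
  - apply persistent_ex, persistent_and; [apply persistent_le|exact Ha].
  - apply persistent_neg_ex, persistent_allle, Na.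
Qed.

Lemma persistent_box a : persistent (Box a).
Proof. apply prov_uclosure_elim, pr_ax, pak4_4. Qed.

Theorem theorem3p5 (phi : form) (Hphi : Sigma1_Box phi) :
  proves PA_K4 (Imp phi (Box phi)).
Proof.
  change (persistent phi).
  induction Hphi as [a H|a|a b _ Ha _ Hb|a b _ Ha _ Hb|a _ Ha|t a _ Ha].
  - induction H as [a H|a _ Ha].
    + apply persistent_delta0, H.
    + apply persistent_ex, Ha.
  - apply persistent_box.
  - apply persistent_and; assumption.
  - apply persistent_or; assumption.
  - apply persistent_ex, Ha.
  - apply persistent_alllt, Ha.
Qed.
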